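(* For integers $n$ and $k$ with $1\leq k\leq n-1$, let $f(n,k)$ be the minimum integer such that every connected graph $G$ of order $n$ with $|E(G)|\geq f(n,k)$ satisfies $rd(G)\geq k$. Then $f(n,k)=\left\lfloor\frac{k(n-1)}{2}\right\rfloor+1$.
   Context: All graphs are simple, finite and undirected. For a nontrivial connected graph $G$ with an edge-coloring (adjacent edges may receive the same color), an edge-cut $R$ (a set of edges whose removal disconnects $G$) is a rainbow cut if no two edges of $R$ have the same color; it separates vertices $u,v$ if $u$ and $v$ lie in different components of $G-R$. The coloring is a rainbow disconnection coloring if for every two distinct vertices $u,v$ there is a rainbow cut separating them. The rainbow disconnection number $rd(G)$ is the smallest number of colors in a rainbow disconnection coloring of $G$.
   Formalization: The equality for f(n,k) is proved for 2 ≤ k ≤ n−1; at k = 1 only the validity of the threshold is stated, since every connected graph of order n ≥ 2 has rd(G) ≥ 1, so every integer works and no minimum integer exists. *)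

(* Defs.v *)
From mathcomp Require Import all_boot.

Set Implicit Arguments.
Unset Strict Implicit.
Unset Printing Implicit Defensive.

Record sgraph (T : finType) := SGraph {
  adj :> rel T;
  adj_sym : symmetric adj;
  adj_irrefl : irreflexive adj
}.

Section RainbowDisconnection.
Variables (T : finType) (G : sgraph T).
Implicit Types (R : {set {set T}}) (u v : T).

Definition edges : {set {set T}} :=
  [set e | [exists x, exists y, G x y && (e == [set x; y])]].

Definition connected_rel (r : rel T) : bool :=
  [forall x, forall y, connect r x y].

Definition del_edges R : rel T :=
  [rel x y | G x y && ([set x; y] \notin R)].

Definition edge_cut R : bool :=
  (R \subset edges) && ~~ connected_rel (del_edges R).

Definition separates R u v : bool := ~~ connect (del_edges R) u v.

(* Colorings are total on {set T}; only their values on edges matter below. *)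
Definition rainbow (r : nat) (c : {ffun {set T} -> 'I_r}) R : bool :=
  [forall e in R, forall f in R, (c e == c f) ==> (e == f)].

Definition rd_coloring (r : nat) (c : {ffun {set T} -> 'I_r}) : bool :=
  [forall u, forall v, (u != v) ==>
    [exists R : {set {set T}},
      [&& edge_cut R, rainbow c R & separates R u v]]].

Definition rd_colorable (r : nat) : bool :=
  [exists c : {ffun {set T} -> 'I_r}, rd_coloring c].

Lemma rd_colorable_ex : exists r, rd_colorable r.
Proof.
exists #|{set T}|; apply/existsP; exists [ffun e => enum_rank e].
apply/forallP=> u; apply/forallP=> v; apply/implyP=> neq_uv.
have sep_uv : separates edges u v.
  apply/negP=> /connectP [[|w p] /=].
    by move=> _ /eqP; rewrite eq_sym (negPf neq_uv).
  case/andP=> /andP [Guw nE] _ _; case/negP: nE; rewrite inE.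
  by apply/existsP; exists u; apply/existsP; exists w; rewrite Guw eqxx.
apply/existsP; exists edges; apply/and3P; split=> //.
- rewrite /edge_cut subxx /=; apply/negP=> /forallP /(_ u) /forallP /(_ v) cuv.
  by rewrite /separates cuv in sep_uv.
- apply/forall_inP=> e _; apply/forall_inP=> f _; rewrite !ffunE.
  by apply/implyP=> /eqP /enum_rank_inj ->.
Qed.

Definition rd : nat := ex_minn rd_colorable_ex.

End RainbowDisconnection.

Definition forces_rd (n k m : nat) : Prop :=
  forall (T : finType) (G : sgraph T),
    #|T| = n -> connected_rel G -> m <= #|edges G| -> k <= rd G.

(* The graph of the function f: [is_f n k m] says f(n,k) is defined and
   equal to m. Pitfall: a connected graph of order n >= 2 has rd >= 1, so
   [forces_rd n 1 m] holds for every m and the minimum is degenerate at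
   k = 1; the closed formula for f can only hold for k >= 2. *)
Definition is_f (n k m : nat) : Prop :=
  forces_rd n k m /\ (forall m', forces_rd n k m' -> m <= m').

(* Main.v *)
Require Import Defs.
From mathcomp Require Import all_boot fingroup all_algebra cyclic zify.

(** If [rd G = r], any two vertices are separated by a cut of at most [r]
    edges. Recursively splitting the vertex set along minimum cuts, and
    uncrossing by submodularity, gives as in the Gomory-Hu theorem [n - 1]
    cuts of size at most [r] that separate all vertices and such that at most
    [n - 1] pairs of vertices are separated only once (the edges of the
    Gomory-Hu tree). Since [G] is simple, counting incidences between edges and
    these cuts gives [2 |E| - (n - 1) <= r (n - 1)].

    For the converse, join a hub to all vertices of a nearly [(k - 2)]-regular
    graph [H] on [n - 1] vertices. The stars of the vertices other than the hub
    are rainbow as soon as [H] has a proper colouring with [k - 1] colours, each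
    hub edge receiving a colour that is missing at its end. Such an [H] is
    obtained from an abelian group of odd order, colouring the edge [xy] by
    [x + y]. *)

Set Implicit Arguments.
Unset Strict Implicit.
Unset Printing Implicit Defensive.

(** * Cut trees of symmetric submodular functions *)

Section CutTree.
Variable T : finType.
Implicit Types (A B X W : {set T}) (L : {set {set T}}) (F : seq {set T}).

Definition splits A x y := (x \in A) != (y \in A).
Definition mult F x y := count (fun A => splits A x y) F.
Definition set_algebra L :=
  (forall A, A \in L -> ~: A \in L) /\
  (forall A B, A \in L -> B \in L -> A :|: B \in L).
(** These are the members of [L] that do not split the complement of [X]. Restricting to them plays
    the role of contracting [~: X] to a point in the Gomory-Hu recursion. *)
Definition nested_in L X := [set A in L | (A \subset X) || (~: X \subset A)].

Lemma splitsC A x y : splits (~: A) x y = splits A x y.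
Proof. by rewrite /splits !inE; do 2!case: (_ \in A). Qed.

Lemma splits_sym A x y : splits A x y = splits A y x.
Proof. by rewrite /splits eq_sym. Qed.

Lemma mult_sym F x y : mult F x y = mult F y x.
Proof. by apply: eq_count => A; rewrite splits_sym. Qed.

Lemma mult_triangle F x y z : mult F x z <= mult F x y + mult F y z.
Proof.
elim: F => //= A F; rewrite /mult /= /splits.
by do 3!case: (_ \in A) => /=; lia.
Qed.

Lemma set_algebraI L A B :
  set_algebra L -> A \in L -> B \in L -> A :&: B \in L.
Proof.
by move=> [LC LU] LA LB; rewrite -[_ :&: _]setCK setCI; apply/LC/LU; apply: LC.
Qed.

Lemma nested_in_algebra L X : set_algebra L -> set_algebra (nested_in L X).
Proof.
move=> [LC LU]; split=> [A | A B]; rewrite !inE.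
  by case/andP=> /LC -> /=; rewrite setCS -[~: A \subset X]setCS setCK orbC.
case/andP=> LA hA /andP[LB hB]; rewrite LU //=.
case/orP: hA => hA; last by rewrite (subset_trans hA) ?subsetUl ?orbT.
case/orP: hB => hB; last by rewrite (subset_trans hB) ?subsetUr ?orbT.
by rewrite subUset hA hB.
Qed.

Lemma nested_in_splits L X A x y :
  A \in nested_in L X -> x \notin X -> y \notin X -> splits A x y = false.
Proof.
rewrite inE /splits => /andP[_ /orP[] /subsetP sA] Xx Xy.
  by rewrite (contraNF (sA x) Xx) (contraNF (sA y) Xy).
by rewrite !sA ?inE.
Qed.

Lemma nested_in_mult L X F x y :
  {subset F <= nested_in L X} -> x \notin X -> y \notin X -> mult F x y = 0.
Proof.
move=> sF Xx Xy; apply/eqP; rewrite -leqn0 leqNgt -has_count.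
by apply/hasPn=> A /sF /nested_in_splits->.
Qed.

Variable d : {set T} -> nat.
Hypothesis dC : forall A, d (~: A) = d A.
Hypothesis d_submod : forall A B, d (A :&: B) + d (A :|: B) <= d A + d B.

(** Intersect [X] with the side of [A] that misses [v]. The union of [X] with that side contains [u]
    but not [v], so its value is at least [d X], and submodularity leaves at most [d A] for the
    intersection. *)
Lemma uncross L X u v a b A :
    set_algebra L -> X \in L -> u \in X -> v \notin X ->
    (forall B, B \in L -> u \in B -> v \notin B -> d X <= d B) ->
    a \in X -> b \in X -> A \in L -> splits A a b ->
  exists B, [/\ B \in nested_in L X, splits B a b & d B <= d A].
Proof.
move=> algL LX Xu Xv Xmin Xa Xb.
wlog Au : A / u \in A.
  move=> IH LA sA; case: (boolP (u \in A)) => [|nAu]; first by move/IH; apply.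
  by rewrite -dC; apply: IH; rewrite ?inE ?splitsC //; case: algL => ->.
move=> LA sA; case: (boolP (v \in A)) => [Av | nAv].
  exists (X :&: ~: A); split.
  - by rewrite !inE set_algebraI ?subsetIl //; case: algL => ->.
  - by move: sA; rewrite /splits !inE Xa Xb; do 2!case: (_ \in A).
  have := Xmin (X :|: ~: A); have := d_submod X (~: A).
  rewrite dC !inE Xu Av (negPf Xv) /=.
  case: (algL) => LC LU /[swap] /(_ (LU _ _ LX (LC _ LA)) isT isT); lia.
exists (X :&: A); split.
- by rewrite !inE set_algebraI ?subsetIl.
- by move: sA; rewrite /splits !inE Xa Xb.
have := Xmin (X :|: A); have := d_submod X A.
rewrite !inE Xu (negPf Xv) (negPf nAv) /=.
case: (algL) => LC LU /[swap] /(_ (LU _ _ LX LA) isT isT); lia.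
Qed.

(** Induction on the number of terminals in [W]. Pairs are ordered, so the last bound is twice the
    number of edges of a tree on [W]. *)
Lemma cut_tree K L W :
    W != set0 -> set_algebra L ->
    {in W &, forall x y, x != y ->
      exists A, [/\ A \in L, splits A x y & d A <= K]} ->
  exists F, [/\ size F = #|W|.-1, {subset F <= L}, all (fun A => d A <= K) F,
    {in W &, forall x y, x != y -> 0 < mult F x y} &
    #|[set p in setX W W | mult F p.1 p.2 == 1]| <= 2 * #|W|.-1].
Proof.
have [m] := ubnP #|W|; elim: m => // m IHm in L W *.
move=> leWm W0 algL sepW.
have [W1 | W_gt1] := leqP #|W| 1.
  exists [::]; split=> //=; first by case: #|W| W1 => [|[]].
    by move=> x y Wx Wy; rewrite (card_le1_eqP W1 x y Wx Wy) eqxx.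
  rewrite (_ : [set _ in _ | _] = set0) ?cards0 //.
  by apply/setP=> p; rewrite !inE andbF.
case/card_gt1P: W_gt1 => u [v [Wu Wv uv]].
pose cand A := [&& A \in L, u \in A, v \notin A & d A <= K].
have [A0 candA0] : exists A, cand A.
  have [A [LA sA dA]] := sepW u v Wu Wv uv.
  case: (boolP (u \in A)) sA => Au sA.
    by exists A; move: sA; rewrite /cand LA Au dA /splits Au; case: (v \in A).
  exists (~: A); rewrite /cand dC dA !inE Au; case: algL => -> //= _.
  by move: sA; rewrite /splits (negPf Au); case: (v \in A).
case: (arg_minnP d candA0) => X /and4P[LX Xu Xv dX] Xmin0.
(* Sets with [d B > K] are not candidates, but they exceed [d X <= K] anyway. *)
have Xmin B : B \in L -> u \in B -> v \notin B -> d X <= d B.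
  move=> LB Bu Bv; case: (leqP (d B) K) => [dB | /ltnW]; last exact: leq_trans.
  by apply: Xmin0; rewrite /cand LB Bu Bv.
have LXC : ~: X \in L by case: algL => ->.
have XCmin B : B \in L -> v \in B -> u \notin B -> d (~: X) <= d B.
  move=> LB Bv Bu; rewrite dC -(dC B); apply: Xmin; rewrite ?inE ?Bv //.
  by case: algL => ->.
have cardW : #|W| = #|W :&: X| + #|W :&: ~: X| by rewrite -setDE cardsID.
have W1u : u \in W :&: X by rewrite inE Wu.
have W2v : v \in W :&: ~: X by rewrite !inE Wv.
have W1_gt0 : 0 < #|W :&: X| by apply/card_gt0P; exists u.
have W2_gt0 : 0 < #|W :&: ~: X| by apply/card_gt0P; exists v.
have [ltW1 ltW2] : #|W :&: X| < m /\ #|W :&: ~: X| < m.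
  by move: leWm W1_gt0 W2_gt0; rewrite cardW; clear; lia.
(* The recursion treats the terminals on the two sides of [X] separately. [F1] will not split [~: X]
   and [F2] will not split [X], so neither family separates two terminals of the other side. *)
have [||||F1 [szF1 sF1 dF1 sepF1 cF1]] := IHm (nested_in L X) (W :&: X).
- exact: ltW1.
- by rewrite -card_gt0.
- exact: nested_in_algebra.
- move=> a b /setIP[Wa Xa] /setIP[Wb Xb] ab.
  have [A [LA sA dA]] := sepW a b Wa Wb ab.
  have [B [LB sB dB]] := uncross algL LX Xu Xv Xmin Xa Xb LA sA.
  by exists B; split=> //; apply: leq_trans dA.
have [||||F2 [szF2 sF2 dF2 sepF2 cF2]] := IHm (nested_in L (~: X)) (W :&: ~: X).
- exact: ltW2.
- by rewrite -card_gt0.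
- exact: nested_in_algebra.
- move=> a b /setIP[Wa Xa] /setIP[Wb Xb] ab.
  have [A [LA sA dA]] := sepW a b Wa Wb ab.
  have [||B [LB sB dB]] := uncross algL LXC _ _ XCmin Xa Xb LA sA.
  + by rewrite inE.
  + by rewrite inE negbK.
  by exists B; split=> //; apply: leq_trans dA.
have mF1 x y : x \notin X -> y \notin X -> mult F1 x y = 0.
  exact: nested_in_mult sF1.
have mF2 x y : x \in X -> y \in X -> mult F2 x y = 0.
  by move=> Xx Xy; apply: nested_in_mult sF2 _ _; rewrite inE negbK.
have mF x y :
    mult (X :: F1 ++ F2) x y = splits X x y + mult F1 x y + mult F2 x y.
  by rewrite /mult /= count_cat addnA.
exists (X :: F1 ++ F2); split.
- rewrite /= size_cat szF1 szF2; move: W1_gt0 W2_gt0.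
  by rewrite cardW; clear; lia.
- move=> A; rewrite inE mem_cat => /or3P[/eqP-> // | /sF1 | /sF2];
    by rewrite inE => /andP[].
- by rewrite /= dX all_cat dF1.
- move=> x y Wx Wy xy; rewrite mF /splits.
  case: (boolP (x \in X)) (boolP (y \in X)) => [] Xx [] Xy //=.
    by have := sepF1 x y; rewrite !inE Wx Wy Xx Xy => /(_ isT isT xy); clear; lia.
  by have := sepF2 x y; rewrite !inE Wx Wy Xx Xy => /(_ isT isT xy); clear; lia.
(* A pair separated by [X] alone joins the unique terminal that [F1] does not
   separate from [~: X] to the unique one that [F2] does not separate from [X]. *)
pose Q := [set p in setX (W :&: X) (W :&: ~: X) |
             (mult F1 p.1 p.2 == 0) && (mult F2 p.1 p.2 == 0)].
have Q1 : #|Q| <= 1.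
  apply/card_le1_eqP=> -[x' y'] [x y]; rewrite !inE /=.
  case/andP=> /andP[/andP[Wx' Xx'] /andP[Wy' Xy']] /andP[/eqP e1' /eqP e2'].
  case/andP=> /andP[/andP[Wx Xx] /andP[Wy Xy]] /andP[/eqP e1 /eqP e2].
  (* If the first coordinates differed, going from [x] through [y] and [y'] to [x'] would bound
     [mult F1 x x'] by zero, against [sepF1]. The second coordinates are treated likewise with
     [F2]. *)
  congr pair; apply/eqP; apply: contraT => ne.
    have := sepF1 x x'; rewrite !inE Wx Wx' Xx Xx' => /(_ isT isT).
    rewrite ne => /(_ isT); have := mult_triangle F1 x y x'.
    have := mult_triangle F1 y y' x'.
    rewrite (mF1 y y') // (mult_sym _ y' x') e1 e1'.
    by clear; lia.
  have := sepF2 y y'; rewrite !inE Wy Wy' Xy Xy' => /(_ isT isT).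
  rewrite ne => /(_ isT); have := mult_triangle F2 y x y'.
  have := mult_triangle F2 x x' y'.
  rewrite (mF2 x x') // (mult_sym _ y x) e2 e2'.
  by clear; lia.
pose swap (p : T * T) := (p.2, p.1).
set P := [set p in setX W W | _]; move: cF1 cF2.
set P1 := [set p in _ | _]; set P2 := [set p in _ | _] => cF1 cF2.
(* With ordered pairs, the two sides and the single crossing pair contribute at most [2 * (#|W :&:
   X| - 1) + 2 * (#|W :&: ~: X| - 1) + 2], which is [2 * (#|W| - 1)]. *)
have sP : P \subset (P1 :|: P2) :|: (Q :|: swap @: Q).
  apply/subsetP=> -[x y]; rewrite !inE mF /splits /= => /andP[/andP[Wx Wy]].
  rewrite Wx Wy.
  case: (boolP (x \in X)) (boolP (y \in X)) => [] Xx [] Xy //=.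
  - by rewrite mF2 // addn0 add0n => ->.
  - by rewrite -addnA eqSS addn_eq0 => ->; rewrite ?orbT.
  - rewrite -addnA eqSS addn_eq0 => m1; apply/imsetP; exists (y, x) => //.
    by rewrite !inE /= Wx Wy Xx Xy /= (mult_sym _ y) (mult_sym F2 y).
  by rewrite mF1 // add0n => ->.
have := subset_leq_card sP.
have : #|swap @: Q| <= #|Q| := leq_imset_card _ _.
have := leq_card_setU (P1 :|: P2) (Q :|: swap @: Q).
have := leq_card_setU P1 P2; have := leq_card_setU Q (swap @: Q).
move=> [h1 _] [h2 _] [h3 _] h4 h5; move: Q1 W1_gt0 W2_gt0 cF1 cF2 h1 h2 h3 h4 h5.
by rewrite cardW; clear; lia.
Qed.

End CutTree.

(** * Edge cuts and the bound on the number of edges *)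

Lemma eq_set2 (T : finType) (a b x y : T) :
  a != b -> [set a; b] = [set x; y] -> (a = x /\ b = y) \/ (a = y /\ b = x).
Proof.
move=> ab /setP E; have := E a; have := E b; rewrite !inE !eqxx orbT /=.
by do 2![move/esym/orP=> [] /eqP ?]; subst; rewrite ?eqxx // in ab *; [right | left].
Qed.

Lemma adj_neq (T : finType) (G : sgraph T) x y : G x y -> x != y.
Proof. by apply: contraTneq => ->; rewrite adj_irrefl. Qed.

Section SimpleGraph.
Variables (T : finType) (G : sgraph T).
Implicit Types A B : {set T}.

(** Each boundary edge is counted once, oriented out of [A]. In this form complementation is a
    reindexing and submodularity holds term by term. *)
Definition cut A := \sum_(p : T * T) [&& G p.1 p.2, p.1 \in A & p.2 \notin A].

Lemma swap_inj : injective (fun p : T * T => (p.2, p.1)).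
Proof. by move=> [a b] [a' b'] [-> ->]. Qed.

Lemma cutC A : cut (~: A) = cut A.
Proof.
rewrite /cut (reindex_inj swap_inj); apply: eq_bigr => -[x y] _ /=.
by rewrite adj_sym !inE negbK [(_ \notin _) && _]andbC.
Qed.

Lemma cut_submod A B : cut (A :&: B) + cut (A :|: B) <= cut A + cut B.
Proof.
rewrite /cut -!big_split; apply: leq_sum => -[x y] _ /=; rewrite !inE.
by case: (G x y) => //; do 2!(case: (_ \in A); case: (_ \in B)).
Qed.

Lemma handshake : \sum_(p : T * T) G p.1 p.2 = 2 * #|edges G|.
Proof.
rewrite -(big_mkcond (fun p => G p.1 p.2) (fun=> 1)) /=.
rewrite (partition_big (fun p => [set p.1; p.2]) [in edges G]) /=; last first.
  move=> [x y] /= Gxy; rewrite inE; apply/existsP; exists x.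
  by apply/existsP; exists y; rewrite Gxy eqxx.
rewrite -sum1_card big_distrr /=; apply: eq_bigr => e; rewrite inE.
case/existsP=> a /existsP[b /andP[Gab /eqP->]].
have ab := adj_neq Gab; rewrite sum1dep_card.
rewrite -[RHS](_ : #|[set (a, b); (b, a)]| = _); last first.
  by rewrite cards2 xpair_eqE (negPf ab).
apply: eq_card => -[x y]; rewrite !inE /= !xpair_eqE.
apply/andP/orP => [[Gxy /eqP/(eq_set2 (adj_neq Gxy))] |]; last first.
  by case=> /andP[/eqP-> /eqP->]; rewrite 1?[G b a]adj_sym Gab // setUC.
by case=> -[-> ->]; rewrite !eqxx; [left | right].
Qed.

(** For adjacent [x] and [y], 2 is at most [mult F x y] plus one if that multiplicity is 1. Summing
    over ordered pairs gives [4 * #|edges G|] on the left, and at most [2 * K * (#|T| - 1)] plus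
    [2 * (#|T| - 1)] on the right. *)
Lemma edges_bound K :
    (forall x y, x != y -> exists2 A : {set T}, splits A x y & cut A <= K) ->
  2 * #|edges G| <= K.+1 * #|T|.-1.
Proof.
move=> sepG; have [T0 | T_gt0] := posnP #|T|.
  rewrite -handshake big1 // => -[x y]; have := max_card (pred1 x).
  by rewrite T0 card1.
have [|||F [szF _ dF sepF cF]] := @cut_tree _ _ cutC cut_submod K setT setT.
- by rewrite -card_gt0 cardsT.
- by split=> *; rewrite inE.
- by move=> x y _ _ /sepG[A]; exists A; rewrite inE.
rewrite cardsT in szF cF.
have sumF : \sum_(p : T * T) G p.1 p.2 * mult F p.1 p.2 <= 2 * (K * #|T|.-1).
  rewrite -szF; elim: F dF {szF sepF cF} => [|A F IH] /=.
    by rewrite big1 // => p; rewrite muln0.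
  case/andP=> dA /IH hF /=.
  (* An edge across [A] gives two ordered pairs, one counted by [cut A] and one by [cut (~: A)]. *)
  rewrite (_ : \sum_p _ = cut A + cut (~: A) +
                          \sum_(p : T * T) G p.1 p.2 * mult F p.1 p.2).
    by rewrite cutC mulnS mulnDr leq_add // mul2n -addnn leq_add.
  rewrite /cut -!big_split; apply: eq_bigr => -[x y] _ /=.
  rewrite /mult /= mulnDr !inE; congr addn; rewrite /splits.
  by case: (G x y) => //; do 2!case: (_ \in A).
have : \sum_(p : T * T) 2 * G p.1 p.2 <=
       \sum_(p : T * T) (G p.1 p.2 * mult F p.1 p.2 + (mult F p.1 p.2 == 1)).
  apply: leq_sum => -[x y] _ /=; case: (boolP (G x y)) => // Gxy.
  have := sepF x y (in_setT _) (in_setT _) (adj_neq Gxy).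
  by case: (mult F x y) => [|[]] // m _; lia.
rewrite -big_distrr /= handshake big_split /=.
rewrite -(big_mkcond (fun p => mult F p.1 p.2 == 1) (fun=> 1)) /= sum1dep_card.
rewrite (_ : #|_| = #|[set p in setX setT setT | mult F p.1 p.2 == 1]|); last first.
  by apply: eq_card => p; rewrite !inE.
move: sumF cF; clear; set a := \sum_p _; set b := #|[set p in _ | _]|.
by set t := _.-1; lia.
Qed.

(** Take for [A] the component of [x] after deleting a rainbow cut [R]. All edges leaving [A] lie in
    [R], and [R] has at most one edge per colour. *)
Lemma rd_colorable_cut r x y :
  rd_colorable G r -> x != y -> exists2 A : {set T}, splits A x y & cut A <= r.
Proof.
case/existsP=> c /forallP/(_ x)/forallP/(_ y)/implyP cP /cP.
case/existsP=> R /and3P[_ /forall_inP rbR sepR].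
have R_r : #|R| <= r.
  rewrite -[r in _ <= r]card_ord -(@card_in_imset _ _ c) ?max_card // => e f Re Rf cef.
  by have /forall_inP/(_ f Rf)/implyP := rbR e Re; rewrite cef eqxx => /(_ isT)/eqP.
pose A := [set z | connect (del_edges G R) x z]; exists A.
  by rewrite /splits !inE connect0 (negPf sepR).
apply: leq_trans R_r; rewrite /cut.
rewrite -(big_mkcond (fun p => [&& G p.1 p.2, p.1 \in A & p.2 \notin A]) (fun=> 1)) /=.
rewrite sum1dep_card -(@card_in_imset _ _ (fun p => [set p.1; p.2])) => [|[a b] [a' b']].
  apply: subset_leq_card; apply/subsetP=> _ /imsetP[[a b] /[swap] -> /=].
  rewrite !inE /= => /and3P[Gab xa]; apply: contraR => Rab.
  by apply: connect_trans xa (connect1 _); rewrite /del_edges /= Gab.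
rewrite !inE /= => /and3P[Gab xa xb] /and3P[_ xa' xb'].
case/(eq_set2 (adj_neq Gab)) => -[e e']; first by rewrite e e'.
by rewrite -e xa in xb'.
Qed.

End SimpleGraph.

Lemma rd_colorable_rd (T : finType) (G : sgraph T) : rd_colorable G (rd G).
Proof. by rewrite /rd; case: ex_minnP. Qed.

Lemma edges_le_rd (T : finType) (G : sgraph T) :
  2 * #|edges G| <= (rd G).+1 * #|T|.-1.
Proof.
apply: edges_bound => x y; apply: rd_colorable_cut; exact: rd_colorable_rd.
Qed.

Lemma rd_leq (T : finType) (G : sgraph T) r : rd_colorable G r -> rd G <= r.
Proof. by rewrite /rd; case: ex_minnP => m _; apply. Qed.

Lemma forces_rd_edges n k : forces_rd n k ((k * (n - 1)) %/ 2 + 1).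
Proof.
move=> T G cardT _ edgesG; rewrite leqNgt; apply/negP=> lt_rd_k.
have := edges_le_rd G; rewrite cardT => bound.
have : (rd G).+1 * n.-1 <= k * (n - 1) by rewrite subn1 leq_mul2r lt_rd_k orbT.
lia.
Qed.

(** * Colourings with rainbow stars, and graphs with a hub *)

Lemma rd_colorable_stars (T D : finType) (G : sgraph T) (h : T)
    (c : T -> T -> D) (S : {set D}) (r : nat) :
    0 < r -> #|S| <= r -> (forall x y, c x y = c y x) ->
    (forall x y, G x y -> c x y \in S) ->
    (forall x, x != h -> {in G x &, injective (c x)}) ->
  rd_colorable G r.
Proof.
case: r => // r _ leSr c_sym cS c_inj.
pose f (z : D) : 'I_r.+1 := inord (index z (enum S)).
have f_inj : {in S &, injective f}.
  move=> z z' Sz Sz' /(congr1 (@nat_of_ord _)); rewrite /f !inordK; last 2 first.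
  - by rewrite (leq_trans _ leSr) // cardE index_mem mem_enum.
  - by rewrite (leq_trans _ leSr) // cardE index_mem mem_enum.
  move=> E; rewrite -(nth_index z (s := enum S) (x := z)) ?mem_enum //.
  by rewrite E nth_index ?mem_enum.
(* An edge takes the colour of whichever orientation is picked, which is harmless by [c_sym]; the
   value on other sets is arbitrary. *)
pose col (e : {set T}) : 'I_r.+1 :=
  if [pick p : T * T | G p.1 p.2 && (e == [set p.1; p.2])] is Some p
  then f (c p.1 p.2) else inord 0.
have colE x y : G x y -> col [set x; y] = f (c x y).
  move=> Gxy; rewrite /col; case: pickP => [[a b] /= | /(_ (x, y))].
    case/andP=> Gab /eqP/(eq_set2 (adj_neq Gxy)) [[-> ->] // | [-> ->]].
    by rewrite c_sym.
  by rewrite /= Gxy eqxx.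
apply/existsP; exists [ffun e => col e].
apply/forallP=> u; apply/forallP=> v; apply/implyP=> uv.
have [w [wh wuv]] : exists w, w != h /\ ((w == u) || (w == v)).
  case: (eqVneq u h) => [uh | uh]; last by exists u; rewrite eqxx.
  by exists v; rewrite eqxx orbT -uh eq_sym.
pose R := [set [set w; y] | y in [set y | G w y]].
have nR x y : del_edges G R x y -> (w != x) && (w != y).
  case/andP=> Gxy; rewrite -negb_or; apply: contra => wxy; apply/imsetP.
  case/orP: wxy => /eqP->; first by exists y; rewrite ?inE.
  by exists x; rewrite ?inE 1?adj_sym // setUC.
(* A path from [u] to [v] would start or end with a step at [w], and no such step survives the
   deletion. *)
have sepR : separates G R u v.
  apply/negP=> /connectP[p]; case/lastP: p => [_ /= e|p z].
    by rewrite e eqxx in uv.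
  rewrite last_rcons rcons_path => /andP[pp pz] vz; subst v.
  case/orP: wuv => /eqP ?; subst w; last by case/andP: (nR _ _ pz); rewrite eqxx.
  case: p pp pz => [_|a p] /=; first by move/nR; rewrite eqxx.
  by case/andP=> /nR; rewrite eqxx.
apply/existsP; exists R; apply/and3P; split=> //.
  apply/andP; split; last by apply: contra sepR => /forallP/(_ u)/forallP/(_ v).
  apply/subsetP=> _ /imsetP[y Gwy ->]; rewrite !inE in Gwy *.
  by apply/existsP; exists w; apply/existsP; exists y; rewrite Gwy eqxx.
apply/forall_inP=> _ /imsetP[y Gwy ->]; apply/forall_inP=> _ /imsetP[z Gwz ->].
rewrite !inE in Gwy Gwz; rewrite !ffunE !colE //; apply/implyP=> /eqP/f_inj E.
by rewrite (c_inj w wh y z Gwy Gwz (E (cS w y Gwy) (cS w z Gwz))).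
Qed.

Lemma big_option (U : finType) (F : option U -> nat) :
  \sum_x F x = F None + \sum_x F (Some x).
Proof.
rewrite (bigD1 None) //=; congr addn; rewrite (reindex_omap Some id) => [|[]] //.
by apply: eq_bigl => x; rewrite eqxx.
Qed.

Section Hub.
Variables (U : finType) (H : sgraph U).

Definition hub_rel : rel (option U) := fun x y =>
  match x, y with
  | Some x, Some y => H x y
  | None, None => false
  | _, _ => true
  end.

Lemma hub_rel_sym : symmetric hub_rel.
Proof. by move=> [x|] [y|] //=; rewrite adj_sym. Qed.

Lemma hub_rel_irrefl : irreflexive hub_rel.
Proof. by move=> [x|] //=; rewrite adj_irrefl. Qed.

Definition hub := SGraph hub_rel_sym hub_rel_irrefl.

Lemma hub_connected : connected_rel hub.
Proof.
have c0 x : connect hub x None by case: x => [x|] //; apply: connect1.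
apply/forallP=> x; apply/forallP=> y; apply: connect_trans (c0 x) _.
by case: y => [y|] //; apply: connect1.
Qed.

Lemma hub_edges : 2 * #|edges hub| = 2 * #|U| + \sum_x #|[set y | H x y]|.
Proof.
rewrite -handshake -(pair_bigA _ (fun x y => nat_of_bool (hub x y))) /=.
rewrite big_option /= big_option /= add0n sum1_card mul2n -addnn -addnA; congr addn.
rewrite -[X in X + _]sum1_card -big_split /=; apply: eq_bigr => x _.
by rewrite big_option /= -sum1dep_card [in RHS]big_mkcond.
Qed.

Variables (D : finType) (c : U -> U -> D) (hc : U -> D) (S : {set D}).

Lemma hub_rd_colorable r :
    0 < r -> #|S| <= r -> (forall x y, c x y = c y x) ->
    (forall x y, H x y -> c x y \in S) -> (forall x, hc x \in S) ->
    (forall x, {in H x &, injective (c x)}) ->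
    (forall x y, H x y -> c x y != hc x) ->
  rd_colorable hub r.
Proof.
move=> r_gt0 leSr c_sym cS hcS c_inj c_hc.
(* The colours are wrapped in [option] so that the pair of the hub with itself has a value even if
   [D] is empty. *)
pose c' (x y : option U) := match x, y with
  | Some x, Some y => Some (c x y)
  | Some x, None | None, Some x => Some (hc x)
  | None, None => None
  end.
apply: (@rd_colorable_stars _ _ hub None c' (Some @: S)) => //.
- by rewrite card_imset //; apply: Some_inj.
- by move=> [x|] [y|] //=; rewrite c_sym.
- by move=> [x|] [y|] //= Hxy; apply: imset_f; auto.
move=> [x|] // _ [y|] [z|] //=; rewrite !unfold_in /= => Hxy Hxz [] E.
- by rewrite (c_inj x y z).
- by have := c_hc x y Hxy; rewrite E eqxx.
- by have := c_hc x z Hxz; rewrite -E eqxx.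
Qed.

End Hub.

(** * Sum graphs on abelian groups of odd order *)

Lemma exists_notin_neq (U : finType) (A : {set U}) x :
  #|A|.+1 < #|U| -> exists2 y, y != x & y \notin A.
Proof.
move=> ltAU; have /card_gt0P[y] : 0 < #|~: (x |: A)|.
  rewrite -(ltn_add2l #|x |: A|) addn0 cardsC (leq_ltn_trans _ ltAU) //.
  by rewrite cardsU1 -add1n leq_add2r leq_b1.
by rewrite !inE negb_or => /andP[]; exists y.
Qed.

Section OddZmodule.
Variable Z : finZmodType.
Hypothesis odd_Z : odd #|Z|.
Import GRing.Theory FinRing.Theory.
Local Open Scope ring_scope.

(** A difference killed by 2 and by the odd order of the group is zero. *)
Lemma double_inj : injective (fun x : Z => x + x).
Proof.
move=> x y /= E; apply/eqP; rewrite -subr_eq0; apply/eqP.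
have d0 : (x - y) *+ 2 = 0 by rewrite mulrnBl !mulr2n E subrr.
have : (x - y) *+ #|Z| = 0.
  by rewrite -zmodXgE -cardsT (expg_cardG (G := [set: Z]%G)) ?inE.
rewrite -(odd_double_half #|Z|) odd_Z -mul2n mulrnDr mulrnA d0 mul0rn addr0.
by [].
Qed.

Lemma double_eq0 (x : Z) : (x + x == 0) = (x == 0).
Proof. by rewrite -(inj_eq double_inj x 0) addr0. Qed.

Lemma symmetric_subset t : (t.*2 < #|Z|)%N ->
  exists C : {set Z}, [/\ #|C| = t.*2, 0 \notin C & {in C, forall x, - x \in C}].
Proof.
elim: t => [_ | t IH lt_t].
  by exists set0; rewrite cards0 inE; split=> // x; rewrite inE.
have [|C [cardC C0 CN]] := IH; first by lia.
have [|c c0 Cc] := @exists_notin_neq _ C 0.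
  by rewrite cardC; apply: leq_trans lt_t; rewrite doubleS.
have CNc : - c \notin C by apply: contra Cc => /CN; rewrite opprK.
have cNc : c != - c by rewrite -subr_eq0 opprK double_eq0.
exists (c |: (- c |: C)); split.
- by rewrite !cardsU1 !inE negb_or cNc Cc CNc cardC.
- by rewrite !inE !(eq_sym 0) oppr_eq0 !negb_or c0 C0.
move=> x; rewrite !inE => /or3P[/eqP->|/eqP->|/CN->]; rewrite ?opprK ?eqxx ?orbT //.
Qed.

(** For odd [s] one element is added to a symmetric set; it alone may lack its opposite, which later
    costs one vertex one degree. *)
Lemma nearly_symmetric_subset s : (s < #|Z|)%N ->
  exists C : {set Z},
    [/\ #|C| = s, 0 \notin C & (#|[set x in C | (- x)%R \notin C]| <= 1)%N].
Proof.
move=> lt_s; have [|C [cardC C0 CN]] := @symmetric_subset s./2; first by lia.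
case: (boolP (odd s)) => s_odd; last first.
  exists C; split=> //; first by lia.
  rewrite (_ : [set _ in _ | _] = set0) ?cards0 //.
  by apply/setP=> x; rewrite !inE; apply/negP=> /andP[/CN->].
have [|c c0 Cc] := @exists_notin_neq _ C 0.
  by rewrite cardC; apply: leq_trans lt_s; lia.
exists (c |: C); split; first by rewrite cardsU1 Cc cardC; lia.
  by rewrite !inE negb_or eq_sym c0.
rewrite -(cards1 c); apply/subset_leq_card/subsetP=> x; rewrite !inE.
by case/andP=> /orP[// | /CN->]; rewrite orbT.
Qed.

Variable C : {set Z}.
Hypothesis C0 : 0 \notin C.

Section OddOrder.

(* Colour [s] misses exactly the vertex [s / 2]; colour [0] is used only to match
   the vertices [s / 2] and [- s / 2] when both miss a colour of [C]. *)
Let sums x : {set Z} :=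
  [set s | (s != x + x) &&
     ((s \in C) || [&& s == 0, x + x \in C & - (x + x) \in C])].

Definition sum_rel : rel Z := fun x y => x + y \in sums x.

(** If [x + y = 0], then [y + y] is the opposite of [x + x], so passing from [x] to [y] swaps the
    two membership conditions. *)
Lemma sum_rel_sym : symmetric sum_rel.
Proof.
move=> x y; rewrite /sum_rel !inE (addrC y x) (inj_eq (addrI x)) eq_sym.
rewrite -{1}(inj_eq (addIr y) x y); case: (boolP (x + y == 0)) => //=.
by rewrite addr_eq0 => /eqP->; rewrite -opprD opprK [(- _ \in C) && _]andbC.
Qed.

Lemma sum_rel_irrefl : irreflexive sum_rel.
Proof. by move=> x; rewrite /sum_rel !inE eqxx. Qed.

Definition sum_graph := SGraph sum_rel_sym sum_rel_irrefl.

(** Translation by [x] matches neighbours with [sums x]. The only colour of [C] that [x] can lose is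
    [x + x], and colour [0] replaces it when [- (x + x)] is in [C] too. *)
Lemma sum_graph_deg x :
  (#|C| <= #|[set y | sum_graph x y]| +
           (((x + x)%R \in C) && ((- (x + x))%R \notin C)))%N.
Proof.
rewrite (_ : [set y | _] = (fun y => x + y) @^-1: sums x); last first.
  by apply/setP=> y; rewrite !inE.
rewrite (card_preimset _ (addrI x)); case: (boolP (x + x \in C)) => Cx /=.
  rewrite (cardsD1 (x + x)) Cx addnC; case: (boolP (_ \in C)) => CNx /=.
    rewrite addn0 addn1 (_ : (_.+1)%N = #|0 |: C :\ (x + x)|).
      apply/subset_leq_card/subsetP=> s; rewrite !inE Cx CNx !andbT.
      case/orP=> [/eqP->|/andP[-> ->] //]; rewrite eqxx orbT andbT.
      by apply: contraNneq C0 => ->.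
    by rewrite cardsU1 !inE (negPf C0) andbF.
  rewrite leq_add2r; apply/subset_leq_card/subsetP=> s.
  by rewrite !inE => /andP[-> ->].
rewrite addn0; apply/subset_leq_card/subsetP=> s Cs; rewrite !inE Cs andbT.
by apply: contraNneq Cx => <-.
Qed.

(** The hub edge at [x] gets [x + x] if this lies in [C], and otherwise [0]; in both cases no edge
    of [sum_graph] at [x] has that colour. *)
Lemma sum_graph_colorable : rd_colorable (hub sum_graph) #|C|.+1.
Proof.
apply: (@hub_rd_colorable _ _ _ (fun x y => x + y)
  (fun x => if x + x \in C then x + x else 0) (0 |: C)) => //.
- by rewrite cardsU1 C0.
- exact: addrC.
- by move=> x y; rewrite /= /sum_rel !inE => /andP[_ /orP[->|/andP[->]]]; rewrite ?orbT.
- by move=> x; case: ifP => Cx; rewrite !inE ?Cx ?orbT ?eqxx.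
- by move=> x y z _ _; apply: addrI.
move=> x y; rewrite /= /sum_rel inE => /andP[xy].
case: ifP => // Cx /orP[Cxy | /and3P[_ //]].
by apply: contraNneq C0 => <-.
Qed.

(** Doubling is injective, so at most one vertex has a deficient degree. *)
Lemma sum_graph_degrees : (#|[set x in C | (- x)%R \notin C]| <= 1)%N ->
  (#|Z| * #|C| <= \sum_x #|[set y | sum_graph x y]| + 1)%N.
Proof.
rewrite -(card_preimset _ double_inj) => le1.
apply: leq_trans (leq_add (leqnn _) le1).
rewrite -sum1dep_card [X in (_ + X)%N]big_mkcond /= -big_split /= -sum_nat_const.
by apply: leq_sum => x _; have := sum_graph_deg x; rewrite !inE.
Qed.

End OddOrder.

Section EvenOrder.

(* [None] is the point at infinity of the usual 1-factorisation of a complete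
   graph of even order: it repairs the vertex [s / 2] missed by colour [s]. *)
Definition inf_sum (x y : option Z) : Z :=
  match x, y with
  | Some x, Some y => x + y
  | Some x, None | None, Some x => x + x
  | None, None => 0
  end.

Definition inf_sum_rel : rel (option Z) :=
  fun x y => (x != y) && (inf_sum x y \in C).

Lemma inf_sumC x y : inf_sum x y = inf_sum y x.
Proof. by case: x y => [x|] [y|] //=; rewrite addrC. Qed.

Lemma inf_sum_rel_sym : symmetric inf_sum_rel.
Proof. by move=> x y; rewrite /inf_sum_rel inf_sumC eq_sym. Qed.

Lemma inf_sum_rel_irrefl : irreflexive inf_sum_rel.
Proof. by move=> x; rewrite /inf_sum_rel eqxx. Qed.

Definition inf_sum_graph := SGraph inf_sum_rel_sym inf_sum_rel_irrefl.

Lemma inf_sum_graph_deg x : #|[set y | inf_sum_graph x y]| = #|C|.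
Proof.
rewrite -sum1dep_card big_mkcond big_option /= /inf_sum_rel; case: x => [x|] /=.
  rewrite -big_mkcond /= sum1dep_card.
  rewrite (_ : [set y | _] = (fun y => x + y) @^-1: (C :\ (x + x))); last first.
    by apply/setP=> y; rewrite !inE (inj_eq (addrI x)) eq_sym.
  by rewrite (card_preimset _ (addrI x)) [RHS](cardsD1 (x + x)); case: (_ \in C).
rewrite add0n -big_mkcond /= sum1dep_card -[RHS](card_preimset _ double_inj).
by apply: eq_card => y; rewrite !inE.
Qed.

(** As [0] is not in [C], colour [0] is free at every vertex and all hub edges share it. *)
Lemma inf_sum_graph_colorable : rd_colorable (hub inf_sum_graph) #|C|.+1.
Proof.
apply: (@hub_rd_colorable _ _ _ inf_sum (fun=> 0) (0 |: C)) => //.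
- by rewrite cardsU1 C0.
- exact: inf_sumC.
- by move=> x y /andP[_ Cxy]; rewrite inE Cxy orbT.
- by move=> x; rewrite !inE eqxx.
- move=> x y z; rewrite !unfold_in /= /inf_sum_rel => /andP[xy _] /andP[xz _].
  case: x y z xy xz => [x|] [y|] [z|] //=; last by move=> _ _ /double_inj->.
  + by move=> _ _ /addrI->.
  + by move=> xy _ /addrI E; rewrite E eqxx in xy.
  + by move=> _ xz /addrI E; rewrite E eqxx in xz.
by move=> x y /andP[_ Cxy]; apply: contraNneq C0 => <-.
Qed.

End EvenOrder.

End OddZmodule.

(** * Extremal graphs and the value of f *)

(** The floor absorbs a degree deficit of 1. *)
Lemma half_degree_sum N e s t :
  2 * e = 2 * N + t -> N * s <= t + 1 -> (s.+2 * N) %/ 2 <= e.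
Proof. by rewrite (mulnC N) !mulSn; lia. Qed.

Lemma extremal_graph n k : 1 < k < n ->
  exists (T : finType) (G : sgraph T),
    [/\ #|T| = n, connected_rel G, rd G < k & (k * (n - 1)) %/ 2 <= #|edges G|].
Proof.
case: k n => [|[|k]] [|[|n]] // /andP[_ ltkn].
(* Now [k] and [n] stand for the original values minus 2. The graph without its hub has [n.+1]
   vertices; if this is even, one of them is the point at infinity. *)
case: (boolP (odd n)) => n_odd; last first.
  have Z_odd : odd #|'I_n.+1| by rewrite card_ord /= n_odd.
  have [|C [cardC C0 CN]] := nearly_symmetric_subset Z_odd (s := k).
    by rewrite card_ord; lia.
  exists (option 'I_n.+1), (hub (sum_graph C)); split.
  - by rewrite card_option card_ord.
  - exact: hub_connected.
  - by rewrite ltnS -cardC; apply/rd_leq/sum_graph_colorable.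
  have := half_degree_sum (hub_edges _) (sum_graph_degrees Z_odd C0 CN).
  by rewrite card_ord cardC subn1.
case: n n_odd ltkn => // n n_even ltkn.
have Z_odd : odd #|'I_n.+1| by rewrite card_ord.
have [|C [cardC C0 _]] := nearly_symmetric_subset Z_odd (s := k).
  by rewrite card_ord; lia.
exists (option (option 'I_n.+1)), (hub (inf_sum_graph C)); split.
- by rewrite !card_option card_ord.
- exact: hub_connected.
- by rewrite ltnS -cardC; apply/rd_leq/inf_sum_graph_colorable.
have deg : #|{: option 'I_n.+1}| * k <= \sum_x #|[set y | inf_sum_graph C x y]| + 1.
  rewrite -sum_nat_const addn1 ltnW // ltnS leq_sum // => x _.
  by rewrite inf_sum_graph_deg // cardC.
have := half_degree_sum (hub_edges _) deg.
by rewrite card_option card_ord subn1.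
Qed.

Theorem theorem3p4 (n k : nat) (hk : 1 <= k <= n - 1) :
  forces_rd n k ((k * (n - 1)) %/ 2 + 1) /\
  (2 <= k -> is_f n k ((k * (n - 1)) %/ 2 + 1)).
Proof.
split=> [|k_gt1]; first exact: forces_rd_edges.
split=> [|m force_m]; first exact: forces_rd_edges.
rewrite addn1 ltnNge; apply/negP=> le_m.
have [|T [G [cardT conG rdG edgesG]]] := @extremal_graph n k; first by lia.
by have := force_m T G cardT conG (leq_trans le_m edgesG); rewrite leqNgt rdG.
Qed.
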